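(* Let $m$ be a positive integer, let $f:\mathbb{Z}_{\geq 0}\to\mathbb{Z}_{\geq 0}$ be an increasing function and let $d\in\mathbb{Z}_{\geq 0}$ be such that $$d\cdot f(i+1)\geq (m+d)f(i)\quad\text{for all } i>0.$$ If $$(m+d)f(i+1)\leq A(d,\,d\cdot f(i)-1)\quad\text{for all } i>0,$$ then $$L_{f,m} < \big\lceil f^{-1}\big(A(m+d,(d+m)f(1)-1)/d\big)\big\rceil.$$
   Context: The Ackermann function $A:\mathbb{Z}_{\geq 0}\times\mathbb{Z}_{\geq 0}\to\mathbb{Z}_{\geq 0}$ is defined by $A(0,n)=n+1$, $A(m+1,0)=A(m,1)$, $A(m+1,n+1)=A(m,A(m+1,n))$ for $m,n\geq 0$. The expressions $A(\cdot,\cdot)$ in the hypotheses and conclusion are understood to be defined, i.e. their arguments are nonnegative integers (in particular $d\cdot f(i)-1\ge 0$ for $i>0$). ''Increasing'' means $f(i)\leq f(j)$ whenever $i\leq j$. For real $x$, $\lceil f^{-1}(x)\rceil$ denotes the least nonnegative integer $k$ such that $f(k)\geq x$. A sequence $\tau_1,\dots,\tau_k$ of $m$-tuples of nonnegative integers is Dicksonian if $\tau_i\nleq\tau_j$ for all $i<j$, where $\leq$ is the product (coordinatewise) order on $\mathbb{Z}_{\geq 0}^m$. Writing $\tau_i=(\tau_1^i,\dots,\tau_m^i)$, the max growth of the sequence is bounded by $f$ if $\max\{\tau_1^i,\dots,\tau_m^i\}\leq f(i)$ for all $1\leq i\leq k$. $L_{f,m}$ denotes the maximal length of a Dicksonian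 sequence of $m$-tuples of nonnegative integers whose max growth is bounded by $f$. *)

(* Defs.v *)
From mathcomp Require Import all_boot all_order all_algebra.

Set Implicit Arguments.
Unset Strict Implicit.
Unset Printing Implicit Defensive.

Fixpoint ackermann (m : nat) : nat -> nat :=
  match m with
  | 0 => succn
  | m'.+1 =>
      fix ackermann_m (n : nat) : nat :=
        match n with
        | 0 => ackermann m' 1
        | n'.+1 => ackermann m' (ackermann_m n')
        end
  end.

Lemma ackermann0n n : ackermann 0 n = n.+1.
Proof. by []. Qed.

Lemma ackermannS0 m : ackermann m.+1 0 = ackermann m 1.
Proof. by []. Qed.

Lemma ackermannSS m n :
  ackermann m.+1 n.+1 = ackermann m (ackermann m.+1 n).
Proof. by []. Qed.

(* Sequences are indexed from 0: [tau i] is the (i+1)-st term of the sequence.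
   The order on [m.-tupleprod nat] is the coordinatewise one. *)
Definition dicksonian (m k : nat) (tau : 'I_k -> m.-tupleprod nat) : Prop :=
  forall i j : 'I_k, i < j -> ~~ (tau i <= tau j)%O.

Definition max_growth_bounded (f : nat -> nat) (m k : nat)
    (tau : 'I_k -> m.-tupleprod nat) : Prop :=
  forall i : 'I_k, \max_(c < m) tnth (tau i) c <= f i.+1.

Definition dicksonian_length (f : nat -> nat) (m k : nat) : Prop :=
  exists tau : 'I_k -> m.-tupleprod nat,
    dicksonian tau /\ max_growth_bounded f tau.

(* [L] is the value of L_{f,m}. *)
Definition is_max_dicksonian_length (f : nat -> nat) (m L : nat) : Prop :=
  dicksonian_length f m L /\ forall k, dicksonian_length f m k -> k <= L.

(* [k] is the value of the ceiling of f^{-1}(x). *)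
Definition is_ceil_inverse (R : realDomainType) (f : nat -> nat) (x : R)
    (k : nat) : Prop :=
  (x <= (f k)%:R)%R /\ forall j, (x <= (f j)%:R)%R -> k <= j.

Lemma tupleprod_leE m (s t : m.-tupleprod nat) :
  (s <= t)%O = [forall c, tnth s c <= tnth t c].
Proof. exact: Order.TupleProdOrder.leEtprod. Qed.

(* Main.v *)
Require Import Defs.
From mathcomp Require Import all_boot all_order all_algebra.
From mathcomp Require Import zify.
From Stdlib Require Import Classical.

(** A Dicksonian sequence is run against a potential that never increases.

    After some terms of the sequence have been chosen, the next one must lie
    above none of them.  The points still available are covered by finitely
    many slices, affine coordinate subspaces of [nat^m], the whole space at
    the start.  A new term [t] in a slice [S] with [j] free coordinates leaves
    of [S] only the points having, at some free coordinate [c], a value below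
    [t c] ([below_cover]).  So [S] is replaced by at most [j * b] slices of
    dimension [j - 1], where [b] bounds the entries of [t] ([size_below]).

    Once [i] terms have been chosen, the potential is obtained from
    [(m + d) * f i.+1 - 1] by applying [ackermann (d + j)] once for each
    slice of dimension [j], in increasing order of [j] ([climb]).  Since [ackermann (e + 1) (n + a)] is
    [ackermann e] iterated [a] times on [ackermann (e + 1) n], one slice of
    dimension [j] pays for [a] slices of dimension [j - 1] at the price of
    lowering the argument by [a] ([climb_trade]).  Here [a <= m * f i.+1], so
    that an argument of at least [d * f i.+1 - 1] remains, from which the upper
    growth hypothesis lets [ackermann d] reach the next argument.

    The potential starts at [ackermann (d + m) ((m + d) * f 1 - 1)] and
    dominates its final argument, [(m + d) * f k.+1 - 1] for a sequence of
    length [k] ([dicksonian_length_bound]); the lower growth hypothesis turns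
    this into a strict bound on [d * f k] when [k > 0].  That hypothesis also makes [f] unbounded, so that the ceiling of the inverse exists and
    bounds all lengths, whence the existence of a maximal length. *)

(** * Strictly increasing functions and the Ackermann hierarchy *)

Lemma strict_homo_addl g x a :
  {homo g : u v / u < v} -> g x + a <= g (x + a).
Proof.
move=> g_incr; elim: a => [|a IHa]; first by rewrite !addn0.
by rewrite !addnS; apply: leq_ltn_trans IHa (g_incr _ _ _).
Qed.

Lemma leq_strict_homo g x : {homo g : u v / u < v} -> x <= g x.
Proof.
by move/(strict_homo_addl g 0 x); rewrite add0n; apply/leq_trans/leq_addl.
Qed.

Lemma iter_strict_homo n g :
  {homo g : u v / u < v} -> {homo iter n g : u v / u < v}.
Proof. by move=> g_incr; elim: n => [//|n IHn] u v /IHn; apply: g_incr. Qed.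

Lemma ltn_ackermann e n : n < ackermann e n.
Proof.
elim: e n => [//|e IHe]; elim=> [|n IHn].
  by rewrite ackermannS0; apply: ltn_trans (IHe 1).
by rewrite ackermannSS; apply: leq_ltn_trans IHn (IHe _).
Qed.

Lemma ackermann_homo_lt e : {homo ackermann e : u v / u < v}.
Proof.
apply: homo_ltn => [y x z|n]; first exact: ltn_trans.
by case: e => [//|e]; rewrite ackermannSS; apply: ltn_ackermann.
Qed.

Lemma ackermann_homo e : {homo ackermann e : u v / u <= v}.
Proof. exact/ltnW_homo/ackermann_homo_lt. Qed.

Lemma leq_ackermann_level e1 e2 n :
  e1 <= e2 -> ackermann e1 n <= ackermann e2 n.
Proof.
move: e1 e2; apply: (@homo_leq _ (ackermann^~ n) leq) => [//|y x z|e]; first exact: leq_trans.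
case: n => [|n]; first by rewrite ackermannS0; apply: ackermann_homo.
by rewrite ackermannSS; apply: ackermann_homo; apply: ltn_ackermann.
Qed.

Lemma ackermannS_addr e n a :
  ackermann e.+1 (n + a) = iter a (ackermann e) (ackermann e.+1 n).
Proof.
by elim: a => [|a IHa]; rewrite ?addn0 // addnS ackermannSS IHa.
Qed.

(** For [e1 < e2] the left side is at most [ackermann e2 n.+1], by the
    recursion equation, and [n.+1 <= ackermann e1 n]. *)
Lemma ackermann_swap e1 e2 n :
  e1 <= e2 ->
  ackermann e1 (ackermann e2 n) <= ackermann e2 (ackermann e1 n).
Proof.
rewrite leq_eqVlt => /predU1P[-> //|]; case: e2 => [//|e2]; rewrite ltnS => le12.
apply: leq_trans (leq_ackermann_level _ _ _ le12) _.
by rewrite -ackermannSS; apply: ackermann_homo; apply: ltn_ackermann.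
Qed.

Lemma iter_ackermann_swap k e1 e2 n :
  e1 <= e2 ->
  iter k (ackermann e1) (ackermann e2 n)
    <= ackermann e2 (iter k (ackermann e1) n).
Proof.
move=> le12; elim: k => [//|k IHk] /=.
exact: leq_trans (ackermann_homo _ _ _ IHk) (ackermann_swap _ _ _ le12).
Qed.

(** * The potential of a multiset of dimensions *)

(** [cnt] gives the multiplicities of a multiset of dimensions; its members
    below [n] act on [x] in increasing order, the dimension [j] acting by
    [ackermann (d + j)].  By [ackermann_swap] this order of composition gives
    the largest value. *)
Fixpoint climb (d : nat) (cnt : nat -> nat) (n x : nat) : nat :=
  if n is n'.+1 then iter (cnt n') (ackermann (d + n')) (climb d cnt n' x)
  else x.

Lemma climb_homo_lt d cnt n : {homo climb d cnt n : u v / u < v}.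
Proof.
elim: n => [//|n IHn] u v /IHn /=.
by apply: iter_strict_homo; apply: ackermann_homo_lt.
Qed.

Lemma climb_homo d cnt n : {homo climb d cnt n : u v / u <= v}.
Proof. exact/ltnW_homo/climb_homo_lt. Qed.

Lemma eq_climb d cnt1 cnt2 n x :
  (forall j, j < n -> cnt1 j = cnt2 j) -> climb d cnt1 n x = climb d cnt2 n x.
Proof.
elim: n => [//|n IHn] eq_cnt /=; rewrite eq_cnt // IHn // => j lt_jn.
by apply: eq_cnt; apply: ltnW.
Qed.

Lemma climb_swap d cnt n j x :
  n <= j.+1 -> climb d cnt n (ackermann (d + j) x)
                 <= ackermann (d + j) (climb d cnt n x).
Proof.
elim: n => [//|n IHn] lt_nj /=.
have homo_n := iter_strict_homo (cnt n) _ (ackermann_homo_lt (d + n)).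
apply: leq_trans (ltnW_homo homo_n (IHn (ltnW lt_nj))) _.
by apply: iter_ackermann_swap; rewrite leq_add2l.
Qed.

(** The levels from [k] on see only the value accumulated below them. *)
Lemma climb_upper d cnt1 cnt2 k n x1 x2 :
  k <= n -> (forall j, k <= j -> cnt1 j = cnt2 j) ->
  climb d cnt1 k x1 <= climb d cnt2 k x2 ->
  climb d cnt1 n x1 <= climb d cnt2 n x2.
Proof.
move=> le_kn eq_cnt le_k; rewrite -(subnKC le_kn).
elim: (n - k) => [|i IHi]; first by rewrite addn0.
rewrite addnS /= eq_cnt ?leq_addr //.
by apply: ltnW_homo IHi; apply: iter_strict_homo; apply: ackermann_homo_lt.
Qed.

Lemma climb_remove0 d cnt1 cnt2 n x y :
  0 < n -> cnt2 0 = (cnt1 0).+1 -> (forall j, 0 < j -> cnt1 j = cnt2 j) ->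
  y <= ackermann d x -> climb d cnt1 n y <= climb d cnt2 n x.
Proof.
move=> n_gt0 cnt0 eq_cnt le_y; apply: (@climb_upper _ _ _ 1) => //=.
rewrite cnt0 iterSr addn0; apply: ltnW_homo le_y.
by apply: iter_strict_homo; apply: ackermann_homo_lt.
Qed.

(** A member [j.+1] traded for [a] members [j].  Below level [j.+1], the
    value reached from [x] exceeds by at least [a] the one reached from
    [x - a], since [climb] is strictly increasing; by [ackermannS_addr] this
    excess pays for the [a] applications of [ackermann (d + j)].  What remains of
    [ackermann (d + j.+1)] moves below the lower levels by [climb_swap], where
    it pays for the passage from [x - a] to [y]. *)
Lemma climb_trade d cnt1 cnt2 n j a x y :
  j.+1 < n -> cnt1 j = a + cnt2 j -> cnt2 j.+1 = (cnt1 j.+1).+1 ->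
  (forall i, i != j -> i != j.+1 -> cnt1 i = cnt2 i) ->
  a <= x -> y <= ackermann (d + j.+1) (x - a) ->
  climb d cnt1 n y <= climb d cnt2 n x.
Proof.
move=> lt_jn cntj cntSj eq_cnt le_ax le_y.
apply: (@climb_upper _ _ _ j.+2) => // [i lt_ji|].
  by apply: eq_cnt; lia.
have homo_iter k e := iter_strict_homo k _ (ackermann_homo_lt e).
have -> : climb d cnt1 j.+2 y
  = iter (cnt1 j.+1) (ackermann (d + j.+1))
      (iter a (ackermann (d + j)) (climb d cnt2 j.+1 y)).
  rewrite /= cntj iterD (eq_climb d cnt1 cnt2 j) // => i lt_ij.
  by apply: eq_cnt; lia.
have -> : climb d cnt2 j.+2 x
  = iter (cnt1 j.+1) (ackermann (d + j.+1))
      (ackermann (d + j.+1) (climb d cnt2 j.+1 x)).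
  by rewrite -iterSr -cntSj.
apply: ltnW_homo; first exact: homo_iter.
have excess : climb d cnt2 j.+1 (x - a) + a <= climb d cnt2 j.+1 x.
  rewrite -{2}(subnK le_ax).
  by apply: strict_homo_addl; apply: climb_homo_lt.
apply: leq_trans (ackermann_homo _ _ _ excess).
rewrite [d + j.+1]addnS ackermannS_addr -addnS.
apply: ltnW_homo; first exact: homo_iter.
by apply: leq_trans (climb_homo _ _ _ _ _ le_y) (climb_swap _ _ _ _ _ _).
Qed.

(** * Slices covering what a Dicksonian sequence leaves available *)

(** An affine coordinate subspace of [nat^m]; [None] marks a free coordinate. *)
Definition slice (m : nat) := {ffun 'I_m -> option nat}.

Section Slices.

Variable m : nat.
Implicit Types (S : slice m) (x t : m.-tupleprod nat).

Definition in_slice S x := [forall c, S c \in [:: None; Some (tnth x c)]].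

Definition free S := [set c | S c == None].

Definition fix_coord S c v : slice m :=
  [ffun c' => if c' == c then Some v else S c'].

(** The slices covering the points of [S] that are not above [t]. *)
Definition below S t : seq (slice m) :=
  flatten [seq [seq fix_coord S c v | v <- iota 0 (tnth t c)]
          | c <- enum (free S)].

Lemma free_fix_coord S c v : free (fix_coord S c v) = free S :\ c.
Proof.
by apply/setP=> c'; rewrite !inE ffunE; case: (eqVneq c' c) => [_|_] /=.
Qed.

Lemma card_free_le S : #|free S| <= m.
Proof. by rewrite -[X in _ <= X]card_ord; apply: max_card. Qed.

(** At a fixed coordinate [x] and [t] agree, so [x] fails to be above [t]
    because of a free one. *)
Lemma below_cover S t x :
  in_slice S t -> in_slice S x -> ~~ (t <= x)%O -> has (in_slice^~ x) (below S t).
Proof.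
move=> /forallP St /forallP Sx; rewrite tupleprod_leE negb_forall.
case/existsP=> c; rewrite -ltnNge => lt_xt.
have cS : c \in enum (free S).
  rewrite mem_enum inE; move: (St c) (Sx c); rewrite !inE.
  by case: eqP => //= _ /eqP-> /eqP[] eq_c; move: lt_xt; rewrite eq_c ltnn.
apply/hasP; exists (fix_coord S c (tnth x c)).
  apply/flattenP; exists [seq fix_coord S c v | v <- iota 0 (tnth t c)].
    exact: map_f.
  by apply: map_f; rewrite mem_iota.
apply/forallP=> c'; rewrite ffunE; case: eqVneq => [->|_]; last exact: Sx.
by rewrite !inE eqxx orbT.
Qed.

Lemma card_free_below S t S' :
  S' \in below S t -> #|free S'|.+1 = #|free S|.
Proof.
case/flattenP=> _ /mapP[c cS ->] /mapP[v _ ->]; rewrite free_fix_coord.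
by rewrite mem_enum in cS; rewrite (cardsD1 c (free S)) cS.
Qed.

Lemma size_below S t b :
  (forall c, tnth t c <= b) -> size (below S t) <= #|free S| * b.
Proof.
move=> t_b; rewrite size_flatten /shape -map_comp sumnE big_map big_enum /=.
rewrite -sum_nat_const; apply: leq_sum => c _.
by rewrite size_map size_iota.
Qed.

Definition free_count (s : seq (slice m)) (j : nat) : nat :=
  count (fun S => #|free S| == j) s.

Lemma free_count_cat s1 s2 j :
  free_count (s1 ++ s2) j = free_count s1 j + free_count s2 j.
Proof. exact: count_cat. Qed.

Lemma free_count_rem s S j :
  S \in s -> free_count s j = (#|free S| == j) + free_count (rem S s) j.
Proof. by move=> /perm_to_rem /permP/(_ (fun S => #|free S| == j)). Qed.

Lemma free_count_below S t j :
  free_count (below S t) j = (#|free S| == j.+1) * size (below S t).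
Proof.
have eq_in : {in below S t,
    (fun S' : slice m => #|free S'| == j) =1 fun=> #|free S| == j.+1}.
  by move=> S' /card_free_below <-; rewrite eqSS.
rewrite /free_count (eq_in_count eq_in); case: eqP => _.
  by rewrite count_predT mul1n.
by rewrite count_pred0.
Qed.

(** Removing from [S] the points above [t] trades one member of the multiset
    of dimensions for [size (below S t)] members one lower. *)
Lemma climb_refine d s S t (x y : nat) :
  S \in s -> size (below S t) <= x ->
  y <= ackermann (d + #|free S|) (x - size (below S t)) ->
  climb d (free_count (rem S s ++ below S t)) m.+1 y
    <= climb d (free_count s) m.+1 x.
Proof.
move=> sS le_ax le_y.
have cntE j : free_count (rem S s ++ below S t) j + (#|free S| == j)
    = free_count s j + (#|free S| == j.+1) * size (below S t).
  by rewrite free_count_cat free_count_below (free_count_rem s S j sS); lia.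
have := card_free_le S; move: le_y cntE; case: #|free S| => [|j] le_y cntE le_jm.
  apply: climb_remove0 => //.
  - by have := cntE 0; rewrite eqxx; lia.
  - by move=> i i_gt0; have := cntE i; case: eqP; lia.
  - by apply: leq_trans le_y _; rewrite addn0; apply: ackermann_homo; lia.
apply: (climb_trade d _ _ _ j (size (below S t))) => //.
- have := cntE j; rewrite eqxx; lia.
- have := cntE j.+1; rewrite eqxx; lia.
- move=> i neq_ij neq_iSj; have := cntE i.
  by rewrite eqSS ![_ == i]eq_sym (negPf neq_ij) (negPf neq_iSj); lia.
Qed.

Lemma climb_whole_space d (n : nat) :
  climb d (free_count [:: [ffun=> None]]) m.+1 n = ackermann (d + m) n.
Proof.
have dimE : #|free [ffun=> None]| = m.
  rewrite -[RHS]card_ord -cardsT; congr #|pred_of_set _|.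
  by apply/setP=> c; rewrite !inE ffunE.
rewrite /= /free_count /= dimE eqxx /=; congr ackermann.
rewrite (eq_climb _ _ (fun=> 0)) => [|j lt_jm].
  by elim: {1}m => //= n ->.
by rewrite gtn_eqF.
Qed.

End Slices.

(** * Bounding the length *)

(** The factor [m + d] is a budget: [m * f i.+1] of it covers the pieces into
    which a slice of dimension at most [m] splits, and [d * f i.+1 - 1] is the
    argument at which the growth hypothesis applies. *)
Lemma dicksonian_length_bound (m : nat) (f : nat -> nat) (d k : nat)
  (df_gt0 : forall i, 0 < i -> 0 < d * f i)
  (f_upper : forall i, 0 < i ->
    (m + d) * f i.+1 <= ackermann d (d * f i - 1)) :
  dicksonian_length f m k ->
  (m + d) * f k.+1 - 1 <= ackermann (d + m) ((m + d) * f 1 - 1).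
Proof.
case=> tau [dick_tau tau_f].
suff cover i : i <= k -> exists2 s : seq (slice m),
    forall x, (forall l : 'I_k, l < i -> ~~ (tau l <= x)%O) ->
      has (in_slice m ^~ x) s
  & climb d (free_count m s) m.+1 ((m + d) * f i.+1 - 1)
      <= ackermann (d + m) ((m + d) * f 1 - 1).
  have [s _] := cover k (leqnn k).
  by apply: leq_trans; apply: leq_strict_homo; apply: climb_homo_lt.
elim: i => [_|i IHi lt_ik].
  exists [:: [ffun=> None]]; last by rewrite climb_whole_space.
  by move=> x _; rewrite /= orbF; apply/forallP=> c; rewrite ffunE.
have [s s_cover s_climb] := IHi (ltnW lt_ik).
pose t := tau (Ordinal lt_ik).
have /hasP[S sS St] : has (in_slice m ^~ t) s.
  by apply: s_cover => l lt_li; apply: dick_tau.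
have le_tf c : tnth t c <= f i.+1.
  by apply: leq_trans (tau_f (Ordinal lt_ik)); apply: (@leq_bigmax _ (tnth t)).
exists (rem S s ++ below m S t) => [x x_free|].
  have /hasP[S' sS' S'x] : has (in_slice m ^~ x) s.
    by apply: s_cover => l lt_li; apply: x_free; apply: ltnW.
  rewrite has_cat; have [eqS|neqS] := eqVneq S' S; apply/orP; [right|left].
    apply: below_cover => //; rewrite -?eqS //.
    exact: (x_free (Ordinal lt_ik) (ltnSn i)).
  apply/hasP; exists S' => //; move: sS'.
  by rewrite (perm_mem (perm_to_rem sS)) inE (negPf neqS).
apply: leq_trans s_climb.
have le_below : size (below m S t) <= m * f i.+1.
  apply: leq_trans (size_below _ _ _ _ le_tf) _.
  by rewrite leq_mul2r card_free_le orbT.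
have := df_gt0 i.+1 isT; have := f_upper i.+1 isT => le_f f_pos.
apply: climb_refine => //; first by rewrite mulnDl; lia.
apply: leq_trans (leq_ackermann_level d _ _ (leq_addr _ _)).
apply: leq_trans (leq_subr _ _) (leq_trans le_f _).
by apply: ackermann_homo; rewrite mulnDl; lia.
Qed.

Lemma dicksonian_length0 f m : dicksonian_length f m 0.
Proof. by exists (fun=> [tuple of nseq m 0]); split; case. Qed.

Lemma bounded_exists_max (P : nat -> Prop) b :
  P 0 -> (forall k, P k -> k <= b) -> exists L, P L /\ forall k, P k -> k <= L.
Proof.
elim: b => [|b IHb] P0 leb; first by exists 0.
case: (classic (P b.+1)) => [PSb|nPSb]; first by exists b.+1.
apply: IHb => // k Pk; have := leb k Pk.
by rewrite leq_eqVlt => /predU1P[eqk|//]; rewrite eqk in Pk.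
Qed.

Theorem lemma2p4 (m : nat) (f : nat -> nat) (d : nat)
  (m_gt0 : 0 < m)
  (f_incr : forall i j : nat, i <= j -> f i <= f j)
  (df_gt0 : forall i : nat, 0 < i -> 0 < d * f i)
  (f_lower : forall i : nat, 0 < i -> (m + d) * f i <= d * f i.+1)
  (f_upper : forall i : nat, 0 < i ->
    (m + d) * f i.+1 <= ackermann d (d * f i - 1)) :
  exists L k : nat,
    [/\ is_max_dicksonian_length f m L,
        is_ceil_inverse f
          ((ackermann (m + d) ((d + m) * f 1 - 1))%N%:R / d%:R : rat)%R k
      & L < k].
Proof.
set B := ackermann _ _.
have d_gt0 : 0 < d by have := df_gt0 1 isT; rewrite muln_gt0 => /andP[].
have f_gt0 i : 0 < i -> 0 < f i by move/df_gt0; rewrite muln_gt0 => /andP[].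
have mdf i : 0 < i -> d * f i < (m + d) * f i.
  by move=> i_gt0; rewrite ltn_mul2r f_gt0 // -addn1 addnC leq_add2r.
have f_grows i : i <= f i.+1.
  elim: i => [//|i IHi]; apply: leq_ltn_trans IHi _; rewrite -(ltn_pmul2l d_gt0).
  by apply: leq_trans (mdf _ _) (f_lower _ _).
have f_lt k : dicksonian_length f m k -> d * f k < B.
  move=> /(dicksonian_length_bound _ _ _ _ df_gt0 f_upper).
  rewrite [d + m in X in X -> _]addnC => le_kB; rewrite /B [d + m]addnC.
  have [->|k_gt0] := posnP k.
    apply: leq_ltn_trans (ltn_ackermann _ _).
    have := mdf 1 isT; have : d * f 0 <= d * f 1 by rewrite leq_mul2l f_incr ?orbT.
    lia.
  apply: leq_trans le_kB; have := mdf k.+1 isT; have := mdf k k_gt0.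
  by have := f_lower k k_gt0; lia.
have le_ceil k : ((B%:R / d%:R : rat) <= (f k)%:R)%R = (B <= d * f k).
  rewrite Num.Theory.ler_pdivrMr ?Num.Theory.ltr0n //.
  by rewrite -GRing.natrM Num.Theory.ler_nat mulnC.
have exB : exists k, B <= d * f k.
  by exists B.+1; apply: leq_trans (f_grows B) (leq_pmull _ d_gt0).
have lt_ceil k j : dicksonian_length f m k -> B <= d * f j -> k < j.
  move=> /f_lt lt_kB le_Bj; rewrite ltnNge; apply/negP => /f_incr le_jk.
  by move: (leq_trans lt_kB le_Bj); rewrite ltn_mul2l d_gt0 ltnNge le_jk.
have [k le_Bk k_min] := ex_minnP exB.
have [L [lenL maxL]] : exists L, is_max_dicksonian_length f m L.
  apply: (bounded_exists_max _ k); first exact: dicksonian_length0.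
  by move=> j /lt_ceil/(_ le_Bk)/ltnW.
exists L, k; split; [by split | | exact: lt_ceil].
by split=> [|j]; rewrite le_ceil //; apply: k_min.
Qed.
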